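(* Let $f:\mathbb{R}^n\to\mathbb{R}$ and $c:\mathbb{R}^n\to\mathbb{R}^{q}$ (with $q\le n$) be twice continuously differentiable, let $l,u\in\mathbb{R}^n$, and let $x_1\in\mathbb{R}^n$. Let $m(\cdot;x_1)$ be the deflation function $m(x;x_1)=\|x-x_1\|^{-p}+\sigma$, with power $p>0$, shift $\sigma\in\mathbb{R}$, and $m(x_1;x_1)=+\infty$. Consider the original problem $$\text{(P)}\qquad \min_{x\in\mathbb{R}^n} f(x)\quad\text{subject to}\quad c(x)=0,\quad l\le x\le u,$$ and the deflated problem $$\text{(D)}\qquad \min_{x\in\mathbb{R}^n,\;y} f(x)\quad\text{subject to}\quad c(x)=0,\quad m(x;x_1)\le y,\quad l\le x\le u.$$ If $(x^*,y^* )$ is a regular KKT point of (D) with $y^*$ finite, and $m(\cdot;x_1)$ is bounded from below, then $x^*$ is a regular KKT point of (P) and $x^*\ne x_1$.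
   Context: Inequalities between vectors are componentwise; $\|\cdot\|$ is the Euclidean norm. The point $x_1$ plays the role of a previously found solution of (P). The function $m(\cdot;x_1)$ is finite and differentiable on $\mathbb{R}^n\setminus\{x_1\}$ and satisfies $\lim_{x\to x_1}m(x;x_1)=\infty$. The variable $y$ in (D) is a scalar decision variable with no constraints other than those displayed. KKT point of (P): a point $x$ for which there exist multipliers $\lambda\in\mathbb{R}^q$, $z_+,z_-\in\mathbb{R}^n$ with $\nabla f(x)+\nabla c(x)^T\lambda+z_+-z_-=0$ (where $\nabla c(x)$ is the $q\times n$ Jacobian), $c(x)=0$, $l\le x\le u$, $z_+\ge 0$, $z_-\ge 0$, $(x-u)^Tz_+=0$, $(x-l)^Tz_-=0$. KKT point of (D): a point $(x,y)$ satisfying the analogous first-order conditions for (D) in the variables $(x,y)$, with an additional multiplier $\eta\ge 0$ for the deflation constraint $m(x;x_1)-y\le 0$ (feasible: $m(x;x_1)\le y$; complementarity: $\eta\,(m(x;x_1)-y)=0$; the stationarity condition is taken with respect to both $x$ and $y$). A feasible point is regular if the gradients (with respect to all decision variables) of the equality constraints and of the active inequality and bound constraints at that point are linearly independent. *)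

(* Defs.v *)
From HB Require Import structures.
From mathcomp Require Import all_boot all_order all_algebra.
From mathcomp Require Import all_classical all_reals all_analysis.

Set Implicit Arguments.
Unset Strict Implicit.
Unset Printing Implicit Defensive.

Import Order.TTheory GRing.Theory Num.Theory.
Import numFieldNormedType.Exports.

Local Open Scope ring_scope.

(* Vectors are row vectors. The norm that the library puts on ['rV[R]_n] is
   the sup norm, hence the explicit Euclidean norm; the two induce the same
   topology, so differentiability and continuity are unaffected. *)

Definition enorm2 (R : realType) (n : nat) (x : 'rV[R]_n) : R :=
  Num.sqrt (\sum_(i < n) x 0 i ^+ 2).

Definition vle (R : realType) (n : nat) (x y : 'rV[R]_n) : Prop :=
  forall i, x 0 i <= y 0 i.

Definition dot (R : realType) (n : nat) (x y : 'rV[R]_n) : R :=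
  \sum_(i < n) x 0 i * y 0 i.

Definition grad (R : realType) (n : nat) (f : 'rV[R]_n -> R) (x : 'rV[R]_n) :
    'rV[R]_n :=
  \row_(i < n) 'D_(delta_mx 0 i) f x.

(* [jacobian (grad f)] is the Hessian of [f]. *)
Definition twice_continuously_differentiable (R : realType) (n : nat)
    (f : 'rV[R]_n -> R) : Prop :=
  [/\ forall x, differentiable f x,
      forall x, differentiable (grad f) x
    & continuous (jacobian (grad f))].

Definition component (R : realType) (n q : nat)
    (c : 'rV[R]_n -> 'rV[R]_q) (j : 'I_q) : 'rV[R]_n -> R :=
  fun x => c x 0 j.

Definition deflation (R : realType) (n : nat) (p sigma : R)
    (x1 x : 'rV[R]_n) : \bar R :=
  if x == x1 then +oo%E else (enorm2 (x - x1) `^ (- p) + sigma)%:E.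

(* The constraint functions of a program are split into equality constraints
   [h x = 0] and inequality constraints [g x <= 0], bounds included.
   [free] is sensitive to repetitions and to opposite vectors: a coordinate
   with [l 0 i = u 0 i] contributes two dependent gradients. *)
Definition regular (R : realType) (N : nat)
    (eqs ineqs : seq ('rV[R]_N -> R)) (x : 'rV[R]_N) : Prop :=
  free ([seq grad h x | h <- eqs] ++
        [seq grad g x | g <- ineqs & g x == 0]).

Definition eq_constraints (R : realType) (n q : nat)
    (c : 'rV[R]_n -> 'rV[R]_q) : seq ('rV[R]_n -> R) :=
  [seq component c j | j <- enum 'I_q].

Definition bound_constraints (R : realType) (n : nat) (l u : 'rV[R]_n) :
    seq ('rV[R]_n -> R) :=
  [seq (fun x : 'rV[R]_n => x 0 i - u 0 i) | i <- enum 'I_n] ++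
  [seq (fun x : 'rV[R]_n => l 0 i - x 0 i) | i <- enum 'I_n].

(* The library's [jacobian c x] is the n x q matrix acting on row vectors on
   the right, i.e. the transpose of the usual q x n Jacobian; so
   [lam *m (jacobian c x)^T] is the row vector form of "J^T lambda". *)
Definition KKT_P (R : realType) (n q : nat)
    (f : 'rV[R]_n -> R) (c : 'rV[R]_n -> 'rV[R]_q) (l u x : 'rV[R]_n) : Prop :=
  exists (lam : 'rV[R]_q) (zp zm : 'rV[R]_n),
    [/\ grad f x + lam *m (jacobian c x)^T + zp - zm = 0,
        c x = 0,
        vle l x /\ vle x u,
        vle 0 zp /\ vle 0 zm
      & dot (x - u) zp = 0 /\ dot (x - l) zm = 0].

Definition regular_KKT_P (R : realType) (n q : nat)
    (f : 'rV[R]_n -> R) (c : 'rV[R]_n -> 'rV[R]_q) (l u x : 'rV[R]_n) : Prop :=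
  KKT_P f c l u x /\ regular (eq_constraints c) (bound_constraints l u) x.

(* Deflated problem: the decision variable is [w = row_mx x y%:M], with
   [x = lsubmx w] and [y = rsubmx w 0 0]. All gradients below are taken with
   respect to [w]. *)

(* [m(x; x1) - y] through the finite part of [m]; it is meaningful only for
   [x != x1], which the feasibility condition of [KKT_D] enforces because it
   is stated with the extended-valued [m]. *)
Definition deflation_constraint (R : realType) (n : nat) (p sigma : R)
    (x1 : 'rV[R]_n) (w : 'rV[R]_(n + 1)) : R :=
  fine (deflation p sigma x1 (lsubmx w)) - rsubmx w 0 0.

Definition KKT_D (R : realType) (n q : nat)
    (f : 'rV[R]_n -> R) (c : 'rV[R]_n -> 'rV[R]_q) (l u : 'rV[R]_n)
    (p sigma : R) (x1 x : 'rV[R]_n) (y : R) : Prop :=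
  let w : 'rV[R]_(n + 1) := row_mx x y%:M in
  exists (lam : 'rV[R]_q) (zp zm : 'rV[R]_n) (eta : R),
    [/\ grad (f \o lsubmx) w + lam *m (jacobian (c \o lsubmx) w)^T
          + eta *: grad (deflation_constraint p sigma x1) w
          + row_mx zp 0 - row_mx zm 0 = 0,
        [/\ c x = 0, (deflation p sigma x1 x <= y%:E)%E, vle l x & vle x u],
        [/\ vle 0 zp, vle 0 zm & 0 <= eta],
        dot (x - u) zp = 0 /\ dot (x - l) zm = 0
      & (eta%:E * (deflation p sigma x1 x - y%:E) = 0)%E].

Definition regular_KKT_D (R : realType) (n q : nat)
    (f : 'rV[R]_n -> R) (c : 'rV[R]_n -> 'rV[R]_q) (l u : 'rV[R]_n)
    (p sigma : R) (x1 x : 'rV[R]_n) (y : R) : Prop :=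
  KKT_D f c l u p sigma x1 x y /\
  regular [seq h \o lsubmx | h <- eq_constraints c]
    (deflation_constraint p sigma x1
       :: [seq g \o lsubmx | g <- bound_constraints l u])
    (row_mx x y%:M : 'rV[R]_(n + 1)).

(* Main.v *)
(** The variable [y] enters (D) only through the deflation constraint, whose
    partial derivative in [y] is [-1]; the [y]-row of the stationarity condition
    thus forces [eta = 0], and the [x]-rows reduce to stationarity for (P).
    Feasibility with a finite [y] rules out [x = x1].  All other gradients of
    (D) are images of those of (P) under the linear map [v |-> row_mx v 0], and
    independence of the images forces independence of the originals. *)
Require Import Defs.
From HB Require Import structures.
From mathcomp Require Import all_boot all_order all_algebra.
From mathcomp Require Import all_classical all_reals all_analysis.

Import Order.TTheory GRing.Theory Num.Theory.
Import numFieldNormedType.Exports.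

Local Open Scope ring_scope.

(** By rank-nullity a linear image of [span s] has dimension at most that of [span s]; freeness of
    the images makes that dimension equal to [size s]. *)
Lemma free_map_linear (K : fieldType) (U V : vectType K)
    (g : {linear U -> V}) (s : seq U) :
  free [seq g x | x <- s] -> free s.
Proof.
rewrite /free size_map => /eqP free_gs; rewrite eqn_leq dim_span /=.
rewrite -free_gs; have -> : [seq g x | x <- s] = [seq linfun g x | x <- s].
  by apply: eq_map => x; rewrite lfunE.
by rewrite -limg_span -(limg_ker_dim (linfun g) (span s)) leq_addl.
Qed.

(** By linearity of [lsubmx] the two difference quotients are the same function, so no
    differentiability is required. *)
Lemma derive_comp_lsubmx (R : realType) (V : normedModType R) (n m : nat)
    (g : 'rV[R]_n -> V) (w v : 'rV[R]_(n + m)) :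
  'D_v (g \o lsubmx) w = 'D_(lsubmx v) g (lsubmx w).
Proof.
by rewrite /derive; under eq_fun do rewrite /= [lsubmx _]linearP.
Qed.

Lemma lsubmx_delta_l (R : realType) (n m : nat) (i : 'I_n) :
  lsubmx (delta_mx 0 (lshift m i) : 'rV[R]_(n + m)) = delta_mx 0 i.
Proof. by apply/rowP => j; rewrite !mxE (inj_eq (@lshift_inj _ _)). Qed.

Lemma lsubmx_delta_r (R : realType) (n m : nat) (i : 'I_m) :
  lsubmx (delta_mx 0 (rshift n i) : 'rV[R]_(n + m)) = 0.
Proof. by apply/rowP => j; rewrite !mxE eq_lrshift andbF. Qed.

Lemma grad_comp_lsubmx (R : realType) (n m : nat) (g : 'rV[R]_n -> R)
    (w : 'rV[R]_(n + m)) :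
  grad (g \o lsubmx) w = row_mx (grad g (lsubmx w)) 0.
Proof.
apply/rowP => k; rewrite mxE derive_comp_lsubmx.
case: (split_ordP k) => i ->.
  by rewrite row_mxEl mxE lsubmx_delta_l.
by rewrite row_mxEr mxE lsubmx_delta_r derive0.
Qed.

(** Smoothness of [c] is assumed componentwise, whereas its Jacobian is read off the differential of
    [c] itself; writing [c] as a finite sum over the standard basis bridges the two. *)
Lemma differentiable_components (R : realType) (n q : nat)
    (c : 'rV[R]_n -> 'rV[R]_q) (x : 'rV[R]_n) :
  (forall j, differentiable (component c j) x) -> differentiable c x.
Proof.
move=> dc.
have -> : c = \sum_(j < q) (fun y => component c j y *: delta_mx 0 j).
  apply/funext => y; rewrite fct_sumE [LHS]row_sum_delta.
  by apply: eq_bigr.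
apply: differentiable_sum => j; exact: differentiableZl.
Qed.

Lemma differentiable_comp_lsubmx (R : realType) (V : normedModType R)
    (n m : nat) (g : 'rV[R]_n -> V) (w : 'rV[R]_(n + m)) :
  differentiable g (lsubmx w) -> differentiable (g \o lsubmx) w.
Proof.
move=> dg; apply: differentiable_comp => //.
apply: differentiable_components => j.
rewrite (_ : component _ j = fun x => x 0 (lshift m j)).
  exact: differentiable_coord.
by apply/funext => x; rewrite /component mxE.
Qed.

Lemma tr_jacobian_comp_lsubmx (R : realType) (n m q : nat)
    (c : 'rV[R]_n -> 'rV[R]_q) (w : 'rV[R]_(n + m)) :
  differentiable c (lsubmx w) ->
  (jacobian (c \o lsubmx) w)^T = row_mx (jacobian c (lsubmx w))^T 0.
Proof.
move=> dc; have dcl := @differentiable_comp_lsubmx _ _ _ m _ _ dc.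
apply/matrixP => j k; rewrite 2![LHS]mxE -deriveE // derive_comp_lsubmx.
case: (split_ordP k) => i ->.
  by rewrite row_mxEl !mxE -deriveE // lsubmx_delta_l.
by rewrite row_mxEr mxE lsubmx_delta_r derive0 mxE.
Qed.

(** A step along [y] leaves [lsubmx w] fixed, so the deflation term cancels and the quotient is
    exactly [-1] for every nonzero [h]. Hence [w] is arbitrary, and [lsubmx w = x1] is allowed. *)
Lemma rsubmx_grad_deflation_constraint (R : realType) (n : nat) (p sigma : R)
    (x1 : 'rV[R]_n) (w : 'rV[R]_(n + 1)) :
  rsubmx (grad (deflation_constraint p sigma x1) w) = const_mx (-1).
Proof.
apply/rowP => i; rewrite {}(ord1 i) !mxE.
apply: cvg_lim; first exact: norm_hausdorff.
apply: (@cvg_trans _ ((fun=> - 1 : R) @ (0 : R)^')%classic); last exact: cvg_cst.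
apply: near_eq_cvg; near=> h.
have h0 : h != 0 by near: h; exact: nbhs_dnbhs_neq.
have -> : (deflation_constraint p sigma x1 \o shift w)
    (h *: delta_mx 0 (rshift n 0)) = deflation_constraint p sigma x1 w - h.
  rewrite /deflation_constraint /= [lsubmx _]linearP /= lsubmx_delta_r.
  by rewrite scaler0 add0r !mxE !eqxx mulr1 opprD addrA addrAC.
by rewrite addrAC subrr add0r scalerN [h^-1 *: h]mulVf.
Unshelve. all: by end_near.
Qed.

Lemma regular_comp_lsubmx (R : realType) (n m : nat)
    (eqs ineqs : seq ('rV[R]_n -> R)) (g : 'rV[R]_(n + m) -> R)
    (w : 'rV[R]_(n + m)) :
  regular [seq h \o lsubmx | h <- eqs] (g :: [seq h \o lsubmx | h <- ineqs]) w ->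
  regular eqs ineqs (lsubmx w).
Proof.
pose emb (v : 'rV[R]_n) := row_mx v (0 : 'rV[R]_m).
have emb_lin : linear emb.
  by move=> a v v'; rewrite /emb scale_row_mx add_row_mx scaler0 addr0.
pose L : {linear 'rV[R]_n -> 'rV[R]_(n + m)} :=
  HB.pack emb (GRing.isLinear.Build _ _ _ _ emb emb_lin).
have gradL (s : seq ('rV[R]_n -> R)) :
    [seq grad h w | h <- [seq h \o lsubmx | h <- s]] =
    [seq L v | v <- [seq grad h (lsubmx w) | h <- s]].
  by rewrite -!map_comp; apply: eq_map => h /=; rewrite grad_comp_lsubmx.
rewrite /regular /= filter_map => freeD; apply: (@free_map_linear _ _ _ L).
rewrite map_cat -!gradL.
(* If [g] is inactive, its gradient is already absent. If active, it sits between the equality and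
   inequality gradients; it is permuted to the front and dropped. *)
case: (g w == 0) freeD => //=.
by rewrite (perm_free (permEl (perm_catCA _ [:: _] _))) free_cons => /andP[].
Qed.

Theorem lemma4p1 (R : realType) (n q : nat) (hqn : (q <= n)%N)
    (f : 'rV[R]_n -> R) (c : 'rV[R]_n -> 'rV[R]_q)
    (hf : twice_continuously_differentiable f)
    (hc : forall j : 'I_q, twice_continuously_differentiable (component c j))
    (l u x1 : 'rV[R]_n) (p sigma : R) (hp : 0 < p)
    (hm : exists M : R, forall x, (M%:E <= deflation p sigma x1 x)%E)
    (xstar : 'rV[R]_n) (ystar : R)
    (hD : regular_KKT_D f c l u p sigma x1 xstar ystar) :
  regular_KKT_P f c l u xstar /\ xstar <> x1.
Proof.
case: hD => -[lam [zp [zm [eta [stat [cx feas lx xu] [zp0 zm0 _] compl _]]]]] reg.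
have dc : differentiable c xstar.
  by apply: differentiable_components => j; case: (hc j).
split; last by move=> ex; move: feas; rewrite ex /deflation eqxx.
split; last first.
  by move/regular_comp_lsubmx: reg; rewrite row_mxKl.
(* The multipliers of (D) other than [eta] serve unchanged; only stationarity is left to prove. *)
exists lam, zp, zm; split=> //.
move: stat; rewrite grad_comp_lsubmx tr_jacobian_comp_lsubmx ?row_mxKl //.
rewrite mul_mx_row mulmx0 => stat.
have eta0 : eta = 0.
  move/(congr1 rsubmx): stat; rewrite !linearD linearN linearZ linear0 /=.
  rewrite !row_mxKr rsubmx_grad_deflation_constraint !add0r oppr0 !addr0.
  by move/rowP/(_ 0); rewrite !mxE mulrN1 => /eqP; rewrite oppr_eq0 => /eqP.
move: stat; rewrite eta0 scale0r addr0 opp_row_mx !add_row_mx.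
by move/(congr1 lsubmx); rewrite row_mxKl linear0.
Qed.
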